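(* Let $n\ge1$, $e\ge 0$ and $t>1$ be integers, $q=(2e+1)t$, and suppose that $(e,q)$ is an $n$-maximal pair. For $M\in\nabla_n(2e+1)_{\mathrm{red}}$ let $\psi(M)=\mathrm{span}(M)/q\mathbb{Z}^n\in LPL^{\infty}(n,e,q)_o$. Then the map $$\psi_{\mathcal{A}}:\frac{\nabla_n(2e+1)_{\mathrm{red}}}{\Gamma_n}\to\frac{LPL^{\infty}(n,e,q)_o}{\mathcal{A}}$$ sending the $\Gamma_n$-equivalence class of $M$ to $[\psi(M)]_{\mathcal{A}}$ is a parametrization (i.e. a well-defined bijection).
   Context: For $a\in\mathbb{Z}_q$ with representative $\tilde a\in\{0,\dots,q-1\}$ put $|a|_1=\min\{\tilde a,q-\tilde a\}$. The maximum metric on $\mathbb{Z}_q^n$ is $d(x,y)=\max_i|x_i-y_i|_1$, and $B(x,r)=\{y\in\mathbb{Z}_q^n: d(x,y)\le r\}$. $LPL^{\infty}(n,e,q)$ is the set of linear perfect codes with packing radius $e$, i.e. of subgroups $C$ of $(\mathbb{Z}_q^n,+)$ with $\#C>1$ such that $\mathbb{Z}_q^n$ is the disjoint union of the balls $B(c,e)$, $c\in C$. Sections: for $I\subseteq[n]=\{1,\dots,n\}$ let $H_I=\{x\in\mathbb{Z}_q^n:x_i=0\ \forall i\in I\}$, let $\pi_I:\mathbb{Z}_q^n\to\mathbb{Z}_q^n$ be the homomorphism that sets the coordinates in $I$ to $0$ and keeps the others, $B(H_I,e)=\bigcup_{h\in H_I}B(h,e)$, and $C\langle I\rangle=\pi_I(B(H_I,e)\cap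 C)$. Ordered codes: a code $D\subseteq\mathbb{Z}_q^n$ is of type $i$ if $D+(2e+1)e_i\subseteq D$ ($e_i$ the $i$-th canonical vector), and $\tau(D)=\max\{i: D\text{ is of type }i\}$. For $C\in LPL^{\infty}(n,e,q)$ define $\wp_1=\tau(C)$, $J_1=\{\wp_1\}$, $C_1=C\langle J_1\rangle$, and for $1\le i<n$, $\wp_{i+1}=\tau(C_i)$, $J_{i+1}=J_i\cup\{\wp_{i+1}\}$, $C_{i+1}=C\langle J_{i+1}\rangle$. (By the Minkowski–Hajós theorem these are well defined and $(\wp_1,\dots,\wp_n)$ is a permutation of $[n]$.) $C$ is ordered if $(\wp_1,\dots,\wp_n)=(n,n-1,\dots,2,1)$. $LPL^{\infty}(n,e,q)_o$ is the set of ordered codes in $LPL^{\infty}(n,e,q)$. Maximality: the pair $(e,q)$ is $n$-maximal if $\#LPL^{\infty}(n,e,q)_o=(2e+1)^{\binom n2}$ (which is the largest possible value). Matrices: $\nabla_n(2e+1)$ is the set of upper triangular $n\times n$ integer matrices with all diagonal entries equal to $2e+1$; $\nabla_n(2e+1)_{\mathrm{red}}$ is its subset of reduced matrices, i.e. those with $|M_{ij}|\le e$ for $1\le i<j\le n$. $\mathrm{span}(M)\subseteq\mathbb{Z}^n$ is the subgroup generated by the rows of $M$, and $\mathrm{span}(M)/q\mathbb{Z}^n$ is viewed as a subgroup of $\mathbb{Z}_q^n$. Equivalences: $\Gamma_n$ is the set of integer $n\times n$ matrices with determinant $\pm1$; $A,B\in\mathcal{M}_n(\mathbb{Z})$ are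 $\Gamma_n$-equivalent if $A=UBV$ for some $U,V\in\Gamma_n$, and $X/\Gamma_n$ denotes the set of classes of this relation on $X\subseteq\mathcal{M}_n(\mathbb{Z})$. Two codes $C_1,C_2\subseteq\mathbb{Z}_q^n$ are $\mathcal{A}$-equivalent if $C_1=f(C_2)$ for some group automorphism $f$ of $\mathbb{Z}_q^n$; $[C]_{\mathcal{A}}$ is the class of $C$ and $X/\mathcal{A}$ the set of classes of codes in $X$. *)

(* Defs.v *)
From HB Require Import structures.
From mathcomp Require Import all_boot all_order all_algebra all_fingroup.
From mathcomp Require Import boolp classical_sets functions.

Set Implicit Arguments.
Unset Strict Implicit.
Unset Printing Implicit Defensive.

Import Order.TTheory GRing.Theory Num.Theory.
Local Open Scope ring_scope.

(* Z_q^n is 'rV['Z_q]_n, which is the right object only for 1 < q.  The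
   coordinate set [n] = {1,...,n} is 'I_n, the ordinal i standing for the
   coordinate i.+1.  Codes are finite sets, {set 'rV['Z_q]_n}. *)

Definition abs1 (q : nat) (a : 'Z_q) : nat := minn a (q - a).

Definition dist_max (n q : nat) (x y : 'rV['Z_q]_n) : nat :=
  (\max_(i < n) abs1 (x 0 i - y 0 i)%R)%N.

Definition cball (n q : nat) (x : 'rV['Z_q]_n) (r : nat) :
    {set 'rV['Z_q]_n} :=
  [set y | (dist_max x y <= r)%N]%SET.

(* The finite group structure of 'rV['Z_q]_n used by group_set, and by Aut
   below, is the additive one. *)
Definition LPL (n e q : nat) : {set {set 'rV['Z_q]_n}} :=
  [set C : {set 'rV['Z_q]_n} |
    [&& group_set C, (1 < #|C|)%N,
        \bigcup_(c in C) cball c e == [set: 'rV['Z_q]_n] &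
        [forall c in C, forall c' in C,
           (c != c') ==> [disjoint cball c e & cball c' e]]]]%SET.

Definition zero_on (n q : nat) (I : {set 'I_n}) : {set 'rV['Z_q]_n} :=
  [set x : 'rV['Z_q]_n | [forall i in I, x 0 i == 0]]%SET.

Definition erase (n q : nat) (I : {set 'I_n}) (x : 'rV['Z_q]_n) :
    'rV['Z_q]_n :=
  \row_j (if j \in I then 0 else x 0 j).

Definition section (n e q : nat) (C : {set 'rV['Z_q]_n}) (I : {set 'I_n}) :
    {set 'rV['Z_q]_n} :=
  (erase I @: ((\bigcup_(h in zero_on q I) cball h e) :&: C))%SET.

Definition of_type (n e q : nat) (D : {set 'rV['Z_q]_n}) (i : 'I_n) : bool :=
  [forall x in D, x + (2 * e + 1)%:R *: delta_mx 0 i \in D].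

(* Numbered from 1 to n; the value 0 means that D is of no type. *)
Definition tau (n e q : nat) (D : {set 'rV['Z_q]_n}) : nat :=
  (\max_(i < n | of_type e D i) i.+1)%N.

(* (J_k, C_k) |-> (J_(k+1), C_(k+1)), started from J_0 = set0 and C_0 = C. *)
Definition next_section (n e q : nat) (C : {set 'rV['Z_q]_n})
    (JD : {set 'I_n} * {set 'rV['Z_q]_n}) :
    {set 'I_n} * {set 'rV['Z_q]_n} :=
  let J := (JD.1 :|: [set i : 'I_n | i.+1 == tau e JD.2])%SET in
  (J, section e C J).

(* wp e C k is \wp_(k+1). *)
Definition wp (n e q : nat) (C : {set 'rV['Z_q]_n}) (k : nat) : nat :=
  tau e (iter k (next_section e C) (finset.set0, C)).2.

Definition ordered_code (n e q : nat) (C : {set 'rV['Z_q]_n}) : bool :=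
  [forall k : 'I_n, wp e C k == n - k]%N.

Definition LPLo (n e q : nat) : {set {set 'rV['Z_q]_n}} :=
  [set C in LPL n e q | ordered_code e C]%SET.

Definition maximal_pair (n e q : nat) : Prop :=
  #|LPLo n e q| = ((2 * e + 1) ^ 'C(n, 2))%N.

Definition nabla (n m : nat) : set 'M[int]_n :=
  [set M | (forall i j : 'I_n, (j < i)%N -> M i j = 0) /\
           (forall i : 'I_n, M i i = m%:Z)]%classic.
Arguments nabla : clear implicits.

Definition nabla_red (n e : nat) : set 'M[int]_n :=
  [set M | nabla n (2 * e + 1)%N M /\
           forall i j : 'I_n, (i < j)%N -> `|M i j| <= e%:Z]%classic.
Arguments nabla_red : clear implicits.

Definition span_rows (n : nat) (M : 'M[int]_n) : set 'rV[int]_n :=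
  [set v | exists u : 'rV[int]_n, v = u *m M]%classic.

Definition qZn (n q : nat) : set 'rV[int]_n :=
  [set v | exists u : 'rV[int]_n, v = q%:Z *: u]%classic.
Arguments qZn : clear implicits.

(* The image of span M under reduction modulo q; it is span M / q Z^n as soon
   as q Z^n is contained in span M. *)
Definition psi (n q : nat) (M : 'M[int]_n) : {set 'rV['Z_q]_n} :=
  [set c : 'rV['Z_q]_n |
    `[< exists2 v : 'rV[int]_n, span_rows M v &
          c = map_mx (fun z : int => z%:~R) v >]]%SET.

Definition Gamma (n : nat) : set 'M[int]_n :=
  [set U | \det U = 1 \/ \det U = -1]%classic.
Arguments Gamma : clear implicits.

Definition Gamma_equiv (n : nat) (A B : 'M[int]_n) : Prop :=
  exists U V : 'M[int]_n, [/\ Gamma n U, Gamma n V & A = U *m B *m V].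

Definition Gamma_class (n : nat) (X : set 'M[int]_n) (M : 'M[int]_n) :
    set 'M[int]_n :=
  [set N | X N /\ Gamma_equiv N M]%classic.

Definition Gamma_quot (n : nat) (X : set 'M[int]_n) : set (set 'M[int]_n) :=
  [set Gamma_class X M | M in X]%classic.

Definition A_equiv (n q : nat) (C1 C2 : {set 'rV['Z_q]_n}) : Prop :=
  exists2 f : {perm 'rV['Z_q]_n},
    f \in Aut [set: 'rV['Z_q]_n]%SET & C1 = (f @: C2)%SET.

(* The class of C among all subsets of Z_q^n. *)
Definition A_class (n q : nat) (C : {set 'rV['Z_q]_n}) :
    set {set 'rV['Z_q]_n} :=
  [set D | A_equiv D C]%classic.

Definition A_quot (n q : nat) (X : {set {set 'rV['Z_q]_n}}) :
    set (set {set 'rV['Z_q]_n}) :=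
  [set A_class C | C in [set C | C \in X]]%classic.

(* Main.v *)
Require Import Defs.
From HB Require Import structures.
From mathcomp Require Import all_boot all_order all_algebra all_fingroup.
From mathcomp Require Import cyclic zify.
From mathcomp Require Import boolp classical_sets functions.

(** Write m = 2e+1.  The lattices spanned by matrices M with m on the diagonal
    and zeros below it have the box [-e,e]^n as a set of representatives of
    Z^n modulo span M (reduce_mod_span): clear the coordinates from left to
    right with centred remainders.

    Parametrization of ordered codes.  That C is ordered says that, for each
    coordinate i, the section of C by the coordinates after i is of type i.
    Since this section contains 0, it contains m e_i, and a codeword lying
    above m e_i lifts to an integer vector with zeros before i, the entry m at
    i, and entries in [-e,e] after i: the i-th row of a reduced matrix
    (ordered_row).  The matrix M of these rows satisfies psi M \subset C.  A
    codeword of C is congruent modulo psi M to a codeword in the box, that is,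
    in the ball B(0,e), and perfection forces the latter to be 0; hence
    psi M = C (psi_eq_of_sub).  The same argument applied to a vector of qZ^n
    shows that qZ^n is contained in span M as soon as psi M is perfect.  So
    every ordered code is psi M for some reduced M.  There are m^C(n,2)
    reduced matrices, so when there are as many ordered codes, psi must map
    every reduced matrix to an ordered code (maximal_psi_mem).

    Comparison of the equivalences.  If M = U N V with U, V unimodular, then
    reduction of V modulo q is an automorphism taking psi N to psi M.  The
    converse cannot go by lifting an automorphism of Z_q^n to a unimodular
    matrix, because its determinant need not be 1 or -1 modulo q.  Instead,
    the Smith form reduces to diagonal matrices with d_1 | d_2 | ... | q, and
    an automorphism preserves the cardinals of the groups k psi(diag d), which
    are the products over i of q / gcd(q, k d_i) (card_multiples_zdiag).
    These numbers determine d (zdiag_invariants_inj), so M and N have the same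
    Smith form. *)

Set Implicit Arguments.
Unset Strict Implicit.
Unset Printing Implicit Defensive.

Import Order.TTheory GRing.Theory Num.Theory.
Local Open Scope ring_scope.

(** * Reduction modulo q *)

Definition modq (m n q : nat) (A : 'M[int]_(m, n)) : 'M['Z_q]_(m, n) :=
  map_mx intr A.

Lemma modqM (m n p q : nat) (A : 'M[int]_(m, n)) (B : 'M_(n, p)) :
  modq q (A *m B) = modq q A *m modq q B.
Proof. exact: map_mxM. Qed.

Lemma modqB (m n q : nat) (A B : 'M[int]_(m, n)) :
  modq q (A - B) = modq q A - modq q B.
Proof. exact: map_mxB. Qed.

Lemma modq_surj (m n q : nat) (x : 'M['Z_q]_(m, n)) : exists A, x = modq q A.
Proof.
exists (map_mx (fun a : 'Z_q => (a : nat)%:Z) x); apply/matrixP=> i j.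
by rewrite !mxE /= -pmulrn Zp_nat valZpK.
Qed.

Lemma psiP (n q : nat) (M : 'M[int]_n) (c : 'rV['Z_q]_n) :
  reflect (exists u : 'rV[int]_n, c = modq q (u *m M)) (c \in psi q M).
Proof.
rewrite inE; apply: (iffP (asboolP _)) => [[v [u ->] ->]|[u ->]]; first by exists u.
by exists (u *m M) => //; exists u.
Qed.

Lemma intr_Zq_eq0 (q : nat) (z : int) :
  (1 < q)%N -> ((z%:~R : 'Z_q) == 0) = (q %| `|z|)%N.
Proof.
move=> q1; have natE (k : nat) : ((k%:R : 'Z_q) == 0) = (q %| k)%N.
  by rewrite -val_eqE /= val_Zp_nat.
by case: (intP z) => [|k|k]; rewrite ?mulrNz ?oppr_eq0 ?abszN -?pmulrn natE.
Qed.

Lemma abs1_intr (q e : nat) (z : int) :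
  (2 * e < q)%N -> (1 < q)%N -> `|z| <= e%:Z -> (abs1 (z%:~R : 'Z_q) <= e)%N.
Proof.
move=> eq q1; rewrite /abs1; case: z => k ke.
  by rewrite -pmulrn val_Zp_nat // modn_small; lia.
have -> : ((Negz k)%:~R : 'Z_q) = (q - k.+1)%:R.
  have kq : (k.+1 <= q)%N by lia.
  by rewrite natrB // pchar_Zp // NegzE mulrNz sub0r -pmulrn.
by rewrite val_Zp_nat // modn_small; lia.
Qed.

(** Codewords close to 0 have small integer lifts; these lifts become the
    entries above the diagonal of a reduced matrix. *)
Lemma intr_abs1 (q e : nat) (a : 'Z_q) :
  (1 < q)%N -> (abs1 a <= e)%N -> exists2 z : int, `|z| <= e%:Z & a = z%:~R.
Proof.
move=> q1; rewrite /abs1 geq_min => /orP[ae|ae].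
  by exists (a : nat)%:Z; [lia | rewrite -pmulrn Zp_nat valZpK].
have aq : (a < q)%N by rewrite -[X in (_ < X)%N](Zp_cast q1) ltn_ord.
exists (- (q - a)%N%:Z); first by lia.
by rewrite mulrNz -pmulrn natrB ?pchar_Zp ?sub0r ?opprK ?Zp_nat ?valZpK // ltnW.
Qed.

Lemma abs1N (q : nat) (a : 'Z_q) : (1 < q)%N -> abs1 (- a) = abs1 a.
Proof.
move=> q1; have aq : (a < q)%N by rewrite -[X in (_ < X)%N](Zp_cast q1) ltn_ord.
rewrite /abs1 /=; move: (nat_of_ord a) aq => b bq; rewrite Zp_cast //.
have [->|b0] := posnP b; first by rewrite subn0 modnn subn0 min0n.
by rewrite modn_small; lia.
Qed.

(** * Lattices of triangular matrices *)

Lemma centered_remainder (e : nat) (x : int) :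
  exists z, `|x - z * (2 * e + 1)%N%:Z| <= e%:Z.
Proof.
pose m := (2 * e + 1)%N%:Z; exists ((x + e%:Z) %/ m)%Z.
have m0 : 0 < m by rewrite /m; lia.
have := divz_eq (x + e%:Z) m; have := modz_ge0 (x + e%:Z) (lt0r_neq0 m0).
have := ltz_pmod (x + e%:Z) m0; set a := _ * m; rewrite /m; lia.
Qed.

(** Row k of M vanishes before column k, so subtracting a multiple of it from v
    keeps the coordinates before k, which are already small, and can make
    coordinate k small because the diagonal entry is 2e+1. *)
Lemma reduce_mod_span (n e : nat) (M : 'M[int]_n) (v : 'rV[int]_n) :
  nabla n (2 * e + 1)%N M ->
  exists u : 'rV_n, forall j, `|(v - u *m M) 0 j| <= e%:Z.
Proof.
move=> [Mlow Mdiag].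
suff red k : exists u : 'rV_n, forall j : 'I_n, (j < k)%N -> `|(v - u *m M) 0 j| <= e%:Z.
  by have [u Hu] := red n; exists u => j; exact: Hu.
elim: k => [|k [u Hu]]; first by exists 0.
have [kn|nk] := ltnP k n; last first.
  by exists u => j _; apply: Hu; exact: leq_trans (ltn_ord j) nk.
pose i := Ordinal kn.
(* z is the quotient to be cleared from coordinate k. *)
have [z Hz] := centered_remainder e ((v - u *m M) 0 i).
exists (u + z *: delta_mx 0 i) => j jk.
have E : (v - (u + z *: delta_mx 0 i) *m M) 0 j = (v - u *m M) 0 j - z * M i j.
  by rewrite mulmxDl -scalemxAl -rowE opprD addrA !mxE.
rewrite E; have [ji|ji] := eqVneq j i; first by rewrite ji Mdiag.
have jk' : (j < k)%N by move: ji; rewrite -val_eqE /=; lia.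
by rewrite Mlow // mulr0 subr0 Hu.
Qed.

(** * Linear perfect codes *)

Lemma mem_cball (n q e : nat) (x y : 'rV['Z_q]_n) :
  reflect (forall i, (abs1 (x 0 i - y 0 i)%R <= e)%N) (y \in cball x e).
Proof.
rewrite inE /dist_max; apply: (iffP (bigmax_leqP _ _ _)) => H i; first exact: H.
by move=> _; exact: H.
Qed.

Lemma LPL_group (n e q : nat) (C : {set 'rV['Z_q]_n}) :
  C \in LPL n e q -> group_set C.
Proof. by rewrite inE => /and4P[]. Qed.

(** group_set speaks the multiplicative language; this restates it in the
    additive one. *)
Lemma codeBD (n q : nat) (C : {set 'rV['Z_q]_n}) :
  group_set C -> (0 \in C) * (forall x y, x \in C -> y \in C -> x - y \in C)
   * (forall x y, x \in C -> y \in C -> x + y \in C).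
Proof.
move=> gC; pose G := group gC; split; last first.
  by move=> x y xC yC; exact: (@groupM _ G).
split; first exact: (group1 G).
by move=> x y xC yC; apply: (@groupM _ G) => //; exact: (@groupVr _ G).
Qed.

(** The balls of radius e around 0 and around c share the point c, and distinct
    codewords have disjoint balls. *)
Lemma LPL_ball0 (n e q : nat) (C : {set 'rV['Z_q]_n}) (c : 'rV_n) :
  C \in LPL n e q -> c \in C -> (forall i, (abs1 (- c 0 i)%R <= e)%N) -> c = 0.
Proof.
rewrite inE => /and4P[gC _ _ /forall_inP dC] cC ce; apply/eqP.
have C0 := (codeBD gC).1.1.
rewrite eq_sym; have /forall_inP/(_ c cC) := dC 0 C0.
case: eqVneq => //= _; rewrite -setI_eq0 => /eqP/setP/(_ c); rewrite !inE.
have /mem_cball : forall i, (abs1 ((0 : 'rV['Z_q]_n) 0 i - c 0 i)%R <= e)%N.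
  by move=> i; rewrite !mxE sub0r.
rewrite inE => -> /=.
have /mem_cball : forall i, (abs1 (c 0 i - c 0 i)%R <= e)%N.
  by move=> i; rewrite subrr /abs1 min0n.
by rewrite inE => ->.
Qed.

(** The codeword represented by r lies in the ball around 0, so it is 0, and the
    only multiple of q in [-e,e] is 0. *)
Lemma LPL_box_eq0 (n e q : nat) (C : {set 'rV['Z_q]_n}) (r : 'rV[int]_n) :
  (1 < q)%N -> (2 * e < q)%N -> C \in LPL n e q -> modq q r \in C ->
  (forall j, `|r 0 j| <= e%:Z) -> r = 0.
Proof.
move=> q1 eq CL rC re.
have r0 : modq q r = 0.
  apply: (LPL_ball0 CL rC) => i; rewrite abs1N // mxE; exact: abs1_intr.
apply/rowP=> j; move/rowP/(_ j): r0; rewrite !mxE => /eqP; rewrite intr_Zq_eq0 //.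
have := re j; case: (posnP `|(r 0 j)%R|%N) => [|p]; first by lia.
by move=> le_e /(dvdn_leq p); lia.
Qed.

(** A codeword c of C differs from an element of psi M by a box vector; the box
    vector is a codeword in the ball around 0, hence 0. *)
Lemma psi_eq_of_sub (n e q : nat) (M : 'M[int]_n) (C : {set 'rV['Z_q]_n}) :
  (1 < q)%N -> (2 * e < q)%N -> nabla n (2 * e + 1)%N M -> C \in LPL n e q ->
  psi q M \subset C -> psi q M = C.
Proof.
move=> q1 eq MN CL MC; apply/eqP; rewrite finset.eqEsubset MC; apply/fintype.subsetP=> c cC.
have [v vE] := modq_surj c; have [u Hu] := reduce_mod_span v MN.
apply/psiP; exists u; rewrite vE; apply/eqP; rewrite -subr_eq0 -modqB.
suff -> : v - u *m M = 0 by rewrite /modq map_mx0.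
apply: (LPL_box_eq0 q1 eq CL) => //; rewrite modqB; apply: (codeBD (LPL_group CL)).1.2.
  by rewrite -vE.
by apply: (fintype.subsetP MC); apply/psiP; exists u.
Qed.

(** The remainder of a vector of qZ^n modulo span M is a box vector whose
    reduction modulo q is in psi M, hence 0. *)
Lemma qZn_sub_span (n e q : nat) (M : 'M[int]_n) :
  (1 < q)%N -> (2 * e < q)%N -> nabla n (2 * e + 1)%N M -> psi q M \in LPL n e q ->
  (qZn n q `<=` span_rows M)%classic.
Proof.
move=> q1 eq MN CL v [w vE]; have [u Hu] := reduce_mod_span v MN.
exists u; apply/eqP; rewrite -subr_eq0; apply/eqP.
apply: (LPL_box_eq0 q1 eq CL) => //.
(* v vanishes modulo q. *)
have -> : modq q (v - u *m M) = modq q ((- u) *m M).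
  rewrite modqB mulNmx /modq map_mxN vE; apply/rowP=> j; rewrite !mxE.
  by rewrite intrM -pmulrn pchar_Zp // mul0r sub0r.
by apply/psiP; exists (- u).
Qed.

(** * Ordered codes *)

Lemma erase0 (n q : nat) (x : 'rV['Z_q]_n) : erase finset.set0 x = x.
Proof. by apply/rowP=> j; rewrite mxE inE. Qed.

(** With this, every step of the construction of the wp, the first one included,
    is a section of C. *)
Lemma section0 (n e q : nat) (C : {set 'rV['Z_q]_n}) : section e C finset.set0 = C.
Proof.
rewrite /section; set B := (\bigcup_(h in _) _)%SET.
have -> : B :&: C = C.
  apply/setP=> x; rewrite inE; case xC: (x \in C); rewrite ?andbF ?andbT //.
  apply/bigcupP; exists x; first by rewrite inE; apply/forall_inP=> i; rewrite inE.
  by apply/mem_cball=> i; rewrite subrr /abs1 min0n.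
apply/setP=> x; apply/imsetP/idP=> [[y yC ->]|xC]; first by rewrite erase0.
by exists x; rewrite ?erase0.
Qed.

Lemma tau_of_type (n e q : nat) (D : {set 'rV['Z_q]_n}) (i : 'I_n) :
  tau e D = i.+1 -> of_type e D i.
Proof.
rewrite /tau; elim/big_ind: _ => // [x y Hx Hy|j jD [/ord_inj <-] //].
by rewrite /maxn; case: ifP.
Qed.

Lemma ordered_sections (n e q : nat) (C : {set 'rV['Z_q]_n}) (k : nat) :
  ordered_code e C -> (k <= n)%N ->
  let J := [set i : 'I_n | (n - k <= i)%N]%SET in
  iter k (next_section e C) (finset.set0, C) = (J, section e C J).
Proof.
move=> /forallP oC; elim: k => [_|k IHk kn] /=.
  suff -> : [set i : 'I_n | (n - 0 <= i)%N]%SET = finset.set0 by rewrite section0.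
  by apply/setP=> i; rewrite !inE subn0 leqNgt ltn_ord.
have /eqP := oC (Ordinal kn); rewrite /wp /= IHk ?(ltnW kn) //= => tauE.
rewrite /next_section /= tauE.
suff -> : ([set i : 'I_n | (n - k <= i)%N] :|: [set i : 'I_n | i.+1 == (n - k)%N])%SET
  = [set i : 'I_n | (n - k.+1 <= i)%N]%SET by [].
by apply/setP=> i; rewrite !inE; lia.
Qed.

Lemma ordered_type (n e q : nat) (C : {set 'rV['Z_q]_n}) (i : 'I_n) :
  ordered_code e C -> of_type e (section e C [set j : 'I_n | (i < j)%N]%SET) i.
Proof.
move=> oC; have ki : (n - i.+1 < n)%N by have := ltn_ord i; lia.
have /forallP/(_ (Ordinal ki))/eqP := oC.
rewrite /wp ordered_sections ?(ltnW ki) //=.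
have -> : (n - (n - i.+1) = i.+1)%N by have := ltn_ord i; lia.
exact: tau_of_type.
Qed.

(** The type i of the section by the coordinates after i, applied to 0, gives a
    codeword c which erases to (2e+1) e_i and is close to a vector that is zero
    after i: its coordinates after i are therefore at distance at most e from
    0. *)
Lemma ordered_row (n e q : nat) (C : {set 'rV['Z_q]_n}) (i : 'I_n) :
  (1 < q)%N -> group_set C -> ordered_code e C ->
  exists r : 'rV[int]_n,
    [/\ modq q r \in C, forall j : 'I_n, (j < i)%N -> r 0 j = 0,
        r 0 i = (2 * e + 1)%N%:Z & forall j : 'I_n, (i < j)%N -> `|r 0 j| <= e%:Z].
Proof.
move=> q1 gC oC; have /forall_inP tC := ordered_type i oC.
set J := [set j : 'I_n | _]%SET in tC.
have sec0 : 0 \in section e C J.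
  apply/imsetP; exists 0; last by apply/rowP=> j; rewrite !mxE if_same.
  rewrite inE (codeBD gC).1.1 andbT; apply/bigcupP; exists 0.
    by rewrite inE; apply/forall_inP=> j _; rewrite mxE.
  by apply/mem_cball=> j; rewrite subrr /abs1 min0n.
have /imsetP[c + cE] := tC 0 sec0; rewrite inE => /andP[/bigcupP[h hJ] hc cC].
have cJ (j : 'I_n) : (i < j)%N -> exists2 z : int, `|z| <= e%:Z & c 0 j = z%:~R.
  move=> ij; apply: intr_abs1 => //; move/mem_cball/(_ j): hc.
  move: hJ; rewrite inE => /forall_inP/(_ j); rewrite inE => /(_ ij)/eqP->.
  by rewrite sub0r abs1N.
have cI (j : 'I_n) : (j <= i)%N -> c 0 j = ((2 * e + 1)%N * (j == i))%N%:R.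
  move=> ji; move/rowP/(_ j): cE; rewrite !mxE inE ltnNge ji /= add0r => <-.
  by rewrite natrM.
have rP (j : 'I_n) : exists z : int, c 0 j = z%:~R /\
   [/\ (j < i)%N -> z = 0, j = i -> z = (2 * e + 1)%N & (i < j)%N -> `|z| <= e%:Z].
  case: (ltngtP i j) => [ij|ji|/ord_inj ij].
  - by have [z] := cJ j ij; exists z; split => //; split=> // E; move: ij; rewrite E ltnn.
  - exists 0; split; first by rewrite cI ?(ltnW ji) // -val_eqE /= ltn_eqF // muln0.
    by split=> // E; move: ji; rewrite E ltnn.
  - by exists (2 * e + 1)%N; split; [rewrite cI ?ij // eqxx muln1 -pmulrn | split].
pose r := \row_j projT1 (cid (rP j)); have rE j : c 0 j = (r 0 j)%:~R /\
   [/\ (j < i)%N -> r 0 j = 0, j = i -> r 0 j = (2 * e + 1)%N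
     & (i < j)%N -> `|r 0 j| <= e%:Z].
  by rewrite mxE; exact: projT2 (cid (rP j)).
exists r; split; last by move=> j; case: (rE j) => _ [].
- by suff -> : modq q r = c by []; apply/rowP=> j; rewrite mxE; have [-> _] := rE j.
- by move=> j; case: (rE j) => _ [].
- by have [_ [_ ->]] := rE i.
Qed.

(** The rows given by ordered_row form a reduced matrix whose image lies in C. *)
Lemma ordered_is_psi (n e q : nat) (C : {set 'rV['Z_q]_n}) :
  (1 < q)%N -> (2 * e < q)%N -> C \in LPLo n e q ->
  exists2 M, nabla_red n e M & psi q M = C.
Proof.
move=> q1 eq; rewrite inE => /andP[CL oC]; have gC := LPL_group CL.
pose r i := projT1 (cid (ordered_row i q1 gC oC)).
have rP i := projT2 (cid (ordered_row i q1 gC oC)).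
pose M : 'M[int]_n := \matrix_i r i.
have redM : nabla_red n e M.
  split; first split.
  - by move=> i j ji; rewrite mxE; case: (rP i) => _ /(_ j ji).
  - by move=> i; rewrite mxE; case: (rP i).
  - by move=> i j ij; rewrite mxE; case: (rP i) => _ _ _ /(_ j ij).
exists M => //; apply: (psi_eq_of_sub q1 eq redM.1 CL).
apply/fintype.subsetP=> _ /psiP[u ->].
have [[C0 _] CD] := codeBD gC.
have CZ (z : int) (x : 'rV['Z_q]_n) : x \in C -> x *~ z \in C.
  move=> xC; have nat k : x *+ k \in C.
    by elim: k => [|k IHk]; rewrite ?mulr0n // mulrS CD.
  case: (intP z) => [|k|k]; [exact: (nat 0)|exact: nat|].
  by rewrite mulrNz -sub0r (codeBD gC).1.2 // nat.
rewrite mulmx_sum_row {1}/modq raddf_sum /=; elim/big_ind: _ => // i _.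
have -> : map_mx intr (u 0 i *: row i M) = modq q (r i) *~ u 0 i; last first.
  by apply: CZ; case: (rP i).
by rewrite rowK -scaler_int; apply/rowP=> j; rewrite !mxE intrM.
Qed.

(** * Counting reduced matrices *)

Definition above_diag (n : nat) : pred ('I_n * 'I_n) := fun p => (p.1 < p.2)%N.

Lemma card_above_diag (n : nat) : #|[pred p | above_diag (n := n) p]| = 'C(n, 2).
Proof.
rewrite -sum1_card -bin2_sum big_mkord.
(* Swap the coordinates, so as to count the i < j for each column j. *)
rewrite (reindex_inj (h := fun p : 'I_n * 'I_n => (p.2, p.1))); last first.
  by apply: inv_inj => -[].
rewrite -(pair_big_dep xpredT (fun j i : 'I_n => i < j)%N (fun _ _ => 1%N)) /=.
apply: eq_bigr => j _.
by rewrite -(big_ord_widen n (fun=> 1%N) (ltnW (ltn_ord j))) sum_nat_const card_ord muln1.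
Qed.

(** The reduced matrix whose entries above the diagonal are given by f, shifted
    so that the residues 0, ..., 2e stand for -e, ..., e. *)
Definition red_mx (n e : nat)
    (f : {ffun {p : 'I_n * 'I_n | above_diag p} -> 'I_(2 * e + 1)}) : 'M[int]_n :=
  \matrix_(i, j) if insub (i, j) is Some p then (f p : nat)%:Z - e%:Z
                 else ((2 * e + 1) * (i == j))%N%:Z.

Lemma red_mx_surj (n e : nat) (M : 'M[int]_n) :
  nabla_red n e M -> exists f, M = @red_mx n e f.
Proof.
move=> [[Mlow Mdiag] Mred].
have lt_m (k : nat) : (minn k (2 * e) < 2 * e + 1)%N by rewrite addn1 ltnS geq_minr.
(* The minimum only serves to make the value an ordinal for every p; it changes
   nothing because |M i j| <= e. *)
exists [ffun p => Ordinal (lt_m `|(M (val p).1 (val p).2 + e%:Z)%R|%N)].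
apply/matrixP=> i j; rewrite mxE; case: insubP => [p pP pE|]; rewrite /above_diag /=.
  by rewrite ffunE pE /=; have := Mred i j pP; lia.
rewrite -leqNgt leq_eqVlt => /orP[/eqP/ord_inj->|ji].
  by rewrite Mdiag eqxx muln1.
by rewrite Mlow // -val_eqE gtn_eqF // muln0.
Qed.

(** The codes psi M, for M reduced, include all ordered codes and are at most
    (2e+1)^'C(n, 2) in number; by maximality they are exactly the ordered
    codes. *)
Lemma maximal_psi_mem (n e q : nat) (M : 'M[int]_n) :
  (1 < q)%N -> (2 * e < q)%N -> maximal_pair n e q -> nabla_red n e M ->
  psi q M \in LPLo n e q.
Proof.
move=> q1 eq maxq /red_mx_surj[f ->].
pose F g := psi q (@red_mx n e g).
have sub : LPLo n e q \subset F @: finset.setT.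
  apply/fintype.subsetP=> C /(ordered_is_psi q1 eq)[N /red_mx_surj[g ->] <-].
  by apply/imsetP; exists g.
suff /eqP -> : LPLo n e q == (F @: finset.setT)%SET by apply/imsetP; exists f.
rewrite eqEcard sub maxq (leq_trans (leq_imset_card _ _)) //.
by rewrite cardsT card_ffun card_ord card_sig card_above_diag.
Qed.

(** * Unimodular equivalence and automorphisms *)

Lemma GammaP (n : nat) (U : 'M[int]_n) : Gamma n U <-> U \in unitmx.
Proof.
rewrite unitmxE; split=> [[]->//|].
by move=> /orP[] /eqP; [left | right].
Qed.

Lemma Gamma_equiv_sym (n : nat) (A B : 'M[int]_n) : Gamma_equiv A B -> Gamma_equiv B A.
Proof.
move=> [U [V [/GammaP uU /GammaP uV ->]]]; exists (invmx U), (invmx V).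
split; [by apply/GammaP; rewrite unitmx_inv..|].
by rewrite -!mulmxA mulmxV // mulmx1 mulKmx.
Qed.

Lemma Gamma_equiv_trans (n : nat) (A B C : 'M[int]_n) :
  Gamma_equiv A B -> Gamma_equiv B C -> Gamma_equiv A C.
Proof.
move=> [U [V [/GammaP uU /GammaP uV ->]]] [W [X [/GammaP uW /GammaP uX ->]]].
exists (U *m W), (X *m V); split; [by apply/GammaP; rewrite unitmx_mul ?uU ?uV ?uW ?uX..|].
by rewrite !mulmxA.
Qed.

Lemma A_equiv_sym (n q : nat) (C D : {set 'rV['Z_q]_n}) : A_equiv C D -> A_equiv D C.
Proof.
move=> [f fA ->]; exists f^-1%g; first by rewrite groupV.
by rewrite -imset_comp (eq_imset _ (permK f)) imset_id.
Qed.

Lemma A_equiv_trans (n q : nat) (C D E : {set 'rV['Z_q]_n}) :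
  A_equiv C D -> A_equiv D E -> A_equiv C E.
Proof.
move=> [f fA ->] [g gA ->]; exists (g * f)%g; first by rewrite groupM.
by rewrite -imset_comp; apply: eq_imset => x; rewrite permM.
Qed.

Lemma A_equiv_refl (n q : nat) (C : {set 'rV['Z_q]_n}) : A_equiv C C.
Proof. by exists 1%g; rewrite ?group1 // (eq_imset _ (@perm1 _)) imset_id. Qed.

Lemma Gamma_equiv_refl (n : nat) (A : 'M[int]_n) : Gamma_equiv A A.
Proof.
by exists 1%:M, 1%:M; split; rewrite ?mul1mx ?mulmx1 //; apply/GammaP; rewrite unitmx1.
Qed.

Lemma mulmx_Aut (n q : nat) (V : 'M[int]_n) : V \in unitmx ->
  exists2 f : {perm 'rV['Z_q]_n}, f \in Aut [set: 'rV['Z_q]_n]%SET &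
    forall x, f x = x *m modq q V.
Proof.
move=> uV.
have inj : injective (fun x : 'rV['Z_q]_n => x *m modq q V).
  apply: (can_inj (g := fun x => x *m modq q (invmx V))) => x.
  by rewrite -mulmxA -modqM mulmxV // /modq map_mx1 mulmx1.
exists (perm inj); last by move=> x; rewrite permE.
rewrite inE; apply/andP; split; first by apply/fintype.subsetP=> x; rewrite inE.
by apply/morphicP=> x y _ _; rewrite !permE; exact: mulmxDl.
Qed.

(** Left multiplication by U does not change the row span, and right
    multiplication by V acts on it as an automorphism. *)
Lemma psi_A_equiv (n q : nat) (M N : 'M[int]_n) :
  Gamma_equiv M N -> A_equiv (psi q M) (psi q N).
Proof.
move=> [U [V [/GammaP uU /GammaP uV ->]]]; have [f fA fE] := mulmx_Aut q uV.
exists f => //; apply/setP=> x; apply/psiP/imsetP=> [[u ->]|[_ /psiP[u ->] ->]].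
  exists (modq q (u *m U *m N)); last by rewrite fE -modqM !mulmxA.
  by apply/psiP; exists (u *m U).
by exists (u *m invmx U); rewrite fE -modqM !mulmxA mulmxKV.
Qed.

(** * Uniqueness of the Smith form from the reduction modulo q *)

Definition multiples (n q k : nat) (C : {set 'rV['Z_q]_n}) : {set 'rV['Z_q]_n} :=
  ((fun x => x *+ k) @: C)%SET.

(** Automorphisms commute with multiplication by k. *)
Lemma card_multiples (n q k : nat) (C D : {set 'rV['Z_q]_n}) :
  A_equiv C D -> #|multiples k C| = #|multiples k D|.
Proof.
move=> [f fA ->]; rewrite -(card_imset (multiples k D) (@perm_inj _ f)).
rewrite /multiples -!imset_comp.
apply: eq_card; apply/setP; apply: eq_imset => x /=.
rewrite -!FinRing.zmodXgE.
have /= <- := morphX (morphm_morphism (Aut_morphic fA)) k (finset.in_setT x).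
by [].
Qed.

Definition zdiag (n : nat) (d : 'I_n -> nat) : 'M[int]_n :=
  diag_mx (\row_i (d i)%:Z).

(** The multiples by k of psi (diag d) form the product of the cyclic subgroups
    of Z_q generated by k d_i, of orders q / gcd(q, k d_i). *)
Lemma card_multiples_zdiag (n q k : nat) (d : 'I_n -> nat) : (1 < q)%N ->
  #|multiples k (psi q (zdiag d))| = (\prod_(i < n) (q %/ gcdn q (k * d i)))%N.
Proof.
move=> q1; pose a i : 'Z_q := (k * d i)%:R.
have -> : multiples k (psi q (zdiag d)) =
   ((fun f : {ffun 'I_n -> 'Z_q} => \row_i f i) @: [set f in family (fun i => <[a i]>%g)])%SET.
  apply/setP=> x; apply/imsetP/imsetP=> [[_ /psiP[u ->] ->]|].
    exists [ffun i => (u 0 i)%:~R * a i].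
      rewrite inE; apply/familyP=> i; rewrite ffunE.
      have -> : (u 0 i)%:~R * a i = (a i *+ ((u 0 i)%:~R : 'Z_q) : 'Z_q).
        by rewrite -mulr_natl Zp_nat valZpK.
      by rewrite -FinRing.zmodXgE mem_cycle.
    apply/rowP=> i; rewrite !mxE ffunE mul_mx_diag mulmxnE !mxE intrM -pmulrn /a natrM.
    by rewrite -[LHS]mulr_natr mulrAC mulrA.
  move=> [f]; rewrite inE => /familyP fa ->.
  have za i : {z | f i = a i *+ z}.
    by have [z _ zE] := cyclePmin (fa i); exists z; rewrite -FinRing.zmodXgE.
  exists (modq q ((\row_i (sval (za i))%:Z) *m zdiag d)); first by apply/psiP; eexists.
  apply/rowP=> i; rewrite mul_mx_diag mulmxnE !mxE intrM -!pmulrn.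
  move: (sval (za i)) (svalP (za i)) => z ->; rewrite -[LHS]mulr_natl -[RHS]mulr_natl /a natrM.
  by rewrite mulrCA.
rewrite card_imset; last first.
  by move=> f g /rowP fg; apply/ffunP=> i; have := fg i; rewrite !mxE.
rewrite cardsE card_family foldrE big_map big_enum /=; apply: eq_bigr => i _.
rewrite -[RHS](_ : #[Zp1 ^+ (k * d i) : 'Z_q]%g = _); last first.
  by rewrite orderXgcd order_Zp1 Zp_cast.
by congr #|<[_]>%g|; rewrite FinRing.zmodXgE.
Qed.

(** Take k = q / d_j, for which q / gcd(q, k b) = d_j / gcd(d_j, b).  On the
    side of d the factors with i >= j are 1 because d_j divides d_i; the
    factors with i < j agree on both sides, so on the side of d' the factors
    with i >= j are 1 too, in particular d_j / gcd(d_j, d'_j). *)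
Lemma zdiag_invariants_dvd (n q : nat) (d d' : 'I_n -> nat) (j : 'I_n) : (0 < q)%N ->
  (forall i j : 'I_n, (i <= j)%N -> (d i %| d j)%N) ->
  (forall i, d i %| q)%N ->
  (forall k, (\prod_(i < n) (q %/ gcdn q (k * d i)))%N
     = (\prod_(i < n) (q %/ gcdn q (k * d' i)))%N) ->
  (forall i : 'I_n, (i < j)%N -> d i = d' i) -> (d j %| d' j)%N.
Proof.
move=> q0 dchain dq prodE eqlt.
have dj0 : (0 < d j)%N := dvdn_gt0 q0 (dq j).
have k0 : (0 < q %/ d j)%N by rewrite divn_gt0 // dvdn_leq.
have quoE b : (q %/ gcdn q (q %/ d j * b) = d j %/ gcdn (d j) b)%N.
  set c := (q %/ d j)%N in k0 *; have -> : q = (c * d j)%N by rewrite divnK.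
  by rewrite -muln_gcdr divnMl.
have := prodE (q %/ d j)%N; under eq_bigr do rewrite quoE; under [RHS]eq_bigr do rewrite quoE.
have split_j (F : 'I_n -> nat) : (\prod_(i < n) F i =
    (\prod_(i < n | i < j) F i) * \prod_(i < n | ~~ (i < j)) F i)%N.
  by rewrite (bigID (fun i : 'I_n => i < j)%N).
rewrite !split_j [X in (_ * X)%N = _]big1 ?muln1 => [|i]; last first.
  by rewrite -leqNgt => /dchain/gcdn_idPl E; rewrite E divnn dj0.
have -> : (\prod_(i < n | i < j) (d j %/ gcdn (d j) (d i)) =
    \prod_(i < n | i < j) (d j %/ gcdn (d j) (d' i)))%N.
  by apply: eq_bigr => i /eqlt ->.
set P := (\prod_(i < n | _) _)%N; set Q := (\prod_(i < n | ~~ _) _)%N.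
have P0 : (0 < P)%N.
  by apply: prodn_gt0 => i; rewrite divn_gt0 ?gcdn_gt0 ?dj0 // dvdn_leq ?dvdn_gcdl.
rewrite -{1}[P]muln1 => /eqP; rewrite eqn_pmul2l // => /eqP.
rewrite /Q (bigD1 j) ?ltnn //= => /esym/eqP; rewrite muln_eq1 => /andP[/eqP E _].
by apply/gcdn_idPl; rewrite -[RHS](divnK (dvdn_gcdl (d j) (d' j))) E mul1n.
Qed.

Lemma zdiag_invariants_inj (n q : nat) (d d' : 'I_n -> nat) : (0 < q)%N ->
  (forall i j : 'I_n, (i <= j)%N -> (d i %| d j)%N) ->
  (forall i j : 'I_n, (i <= j)%N -> (d' i %| d' j)%N) ->
  (forall i, d i %| q)%N -> (forall i, d' i %| q)%N ->
  (forall k, (\prod_(i < n) (q %/ gcdn q (k * d i)))%N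
     = (\prod_(i < n) (q %/ gcdn q (k * d' i)))%N) ->
  d =1 d'.
Proof.
move=> q0 dc dc' dq dq' prodE j.
have [k] := ubnP (j : nat); elim: k j => // k IHk j jk.
have eqlt (i : 'I_n) : (i < j)%N -> d i = d' i by move=> ij; apply: IHk; lia.
apply/eqP; rewrite eqn_dvd (zdiag_invariants_dvd q0 dc dq prodE) //=.
by apply: (zdiag_invariants_dvd q0 dc' dq' (fun k => esym (prodE k))) => i /eqlt.
Qed.

(** The signs of the Smith invariants are absorbed into the left unimodular
    factor.  Since qZ^n lies in span M, there is U with U M = q; for M = L D R
    this gives (R U L) D = q, so each d_i divides q. *)
Lemma Smith_zdiag (n q : nat) (M : 'M[int]_n) : (0 < q)%N ->
  (qZn n q `<=` span_rows M)%classic ->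
  exists d : 'I_n -> nat,
    [/\ forall i j : 'I_n, (i <= j)%N -> (d i %| d j)%N, forall i, (d i %| q)%N
      & Gamma_equiv M (zdiag d)].
Proof.
move=> q0 qM; have [L uL [R uR [d dsorted ME]]] := int_Smith_normal_form M.
set D := \matrix_(i, j) _ in ME.
exists (fun i => `|(d`_i)%R|%N).
have UM : exists U, U *m M = q%:Z%:M.
  have H i : exists u : 'rV_n, q%:Z *: delta_mx 0 i = u *m M.
    by apply: qM; exists (delta_mx 0 i).
  exists (\matrix_i projT1 (cid (H i))); apply/row_matrixP=> i.
  rewrite row_mul rowK -(projT2 (cid (H i))); apply/rowP=> j.
  by rewrite !mxE /= mulr_natr eq_sym.
have dq (i : 'I_n) : (`|(d`_i)%R| %| q)%N.
  have [U UE] := UM; have : (R *m U *m L) *m D = q%:Z%:M.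
    move: UE; rewrite ME => /(congr1 (fun X => R *m X *m invmx R)).
    rewrite !mulmxA mulmxK // => ->; rewrite -scalemx1 -scalemxAr mulmx1 -scalemxAl mulmxV //.
  move=> /matrixP/(_ i i); rewrite !mxE eqxx (bigD1 i) //= big1 ?addr0 => [|j ji].
    rewrite [D _ _]mxE eqxx mulr1n => /(congr1 absz); rewrite abszM absz_nat => <-.
    exact: dvdn_mull.
  by rewrite [D _ _]mxE val_eqE (negPf ji) mulr0n mulr0.
have dn0 (i : 'I_n) : d`_i != 0 by apply/eqP=> E; move: (dq i); rewrite E dvd0n; lia.
split=> //.
  move=> i j ij; have jd : (j < size d)%N.
    by rewrite ltnNge; apply: contra (dn0 j) => h; rewrite nth_default.
  have := sorted_leq_nth dvdz_trans dvdzz 0 dsorted.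
  move=> /(_ i j); rewrite !inE => /(_ (leq_ltn_trans ij jd) jd ij).
  by rewrite dvdzE.
pose S : 'M[int]_n := diag_mx (\row_i sgz d`_i).
exists (L *m S), R; split.
- apply/GammaP; rewrite unitmx_mul uL unitmxE det_diag.
  apply: rpred_prod => i _; rewrite mxE; have := dn0 i.
  by case: sgzP.
- exact/GammaP.
rewrite ME; congr (_ *m _); rewrite -mulmxA; congr (_ *m _).
rewrite /zdiag mul_diag_mx; apply/matrixP=> i j; rewrite !mxE.
have [->|ij] := eqVneq i j; first by rewrite !eqxx !mulr1n -intEsg.
by rewrite val_eqE (negPf ij) !mulr0n mulr0.
Qed.

(** Both M and N are equivalent to their Smith forms, whose codes are then
    equivalent too; this reduces the claim to diagonal matrices. *)
Lemma A_equiv_psi (n q : nat) (M N : 'M[int]_n) : (1 < q)%N ->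
  (qZn n q `<=` span_rows M)%classic -> (qZn n q `<=` span_rows N)%classic ->
  A_equiv (psi q M) (psi q N) -> Gamma_equiv M N.
Proof.
move=> q1 qM qN MN; have q0 := ltnW q1.
have [d [dc dq Md]] := Smith_zdiag q0 qM; have [d' [dc' dq' Nd]] := Smith_zdiag q0 qN.
suff dd' : d =1 d'.
  apply: (Gamma_equiv_trans Md); apply: Gamma_equiv_sym; apply: (Gamma_equiv_trans Nd).
  have -> : d' = d by apply/funext=> i; rewrite dd'.
  exact: Gamma_equiv_refl.
apply: (zdiag_invariants_inj q0 dc dc' dq dq') => k.
rewrite -!card_multiples_zdiag //; apply: card_multiples.
apply: (A_equiv_trans (A_equiv_sym (psi_A_equiv q Md))).
exact: (A_equiv_trans MN (psi_A_equiv q Nd)).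
Qed.

(** * The parametrization *)

Lemma Gamma_class_eqP (n : nat) (X : set 'M[int]_n) (M N : 'M[int]_n) :
  X M -> Gamma_class X M = Gamma_class X N <-> Gamma_equiv M N.
Proof.
move=> XM; split=> [E|MN].
  have : Gamma_class X M M by split=> //; exact: Gamma_equiv_refl.
  by rewrite E => -[].
apply/seteqP; split=> A [XA AE]; split=> //; first exact: Gamma_equiv_trans AE MN.
exact: Gamma_equiv_trans AE (Gamma_equiv_sym MN).
Qed.

Lemma A_class_eqP (n q : nat) (C D : {set 'rV['Z_q]_n}) :
  A_class C = A_class D <-> A_equiv C D.
Proof.
split=> [E|CD]; first by have : A_class C C := A_equiv_refl C; rewrite E.
apply/seteqP; split=> A AE; first exact: A_equiv_trans AE CD.
exact: A_equiv_trans AE (A_equiv_sym CD).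
Qed.

Theorem theorem5p29 (n e t q : nat) (hn : (1 <= n)%N) (ht : (1 < t)%N)
    (hq : q = ((2 * e + 1) * t)%N) (hmax : maximal_pair n e q) :
  (forall M : 'M[int]_n, nabla_red n e M ->
     subset (qZn n q) (span_rows M) /\ psi q M \in LPLo n e q) /\
  (exists psiA : set 'M[int]_n -> set {set 'rV['Z_q]_n},
     (forall M : 'M[int]_n, nabla_red n e M ->
        psiA (Gamma_class (nabla_red n e) M) = A_class (psi q M)) /\
     set_bij (Gamma_quot (nabla_red n e)) (A_quot (LPLo n e q)) psiA).
Proof.
have eq : (2 * e < q)%N by rewrite hq; nia.
have q1 : (1 < q)%N by rewrite hq; nia.
have psi_LPLo M := maximal_psi_mem q1 eq hmax (M := M).
have qM M : nabla_red n e M -> (qZn n q `<=` span_rows M)%classic.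
  move=> redM; apply: (qZn_sub_span q1 eq redM.1).
  by have := psi_LPLo M redM; rewrite inE => /andP[].
split=> [M redM|]; first by split; [exact: qM | exact: psi_LPLo].
(* The union of the classes of psi M over the members M of X; on a class X they
   all coincide, so no representative has to be chosen. *)
exists (fun X => [set D | exists2 M, X M & A_equiv D (psi q M)]%classic).
set psiA := (X in set_bij _ _ X).
have psiAE M : nabla_red n e M -> psiA (Gamma_class (nabla_red n e) M) = A_class (psi q M).
  move=> redM; apply/seteqP; split=> D.
    by move=> [N [_ NM] DN]; exact: A_equiv_trans DN (psi_A_equiv q NM).
  by move=> DM; exists M => //; split=> //; exact: Gamma_equiv_refl.
split=> //; split.
- move=> _ [M redM <-]; rewrite psiAE //.
  by exists (psi q M) => //; exact: psi_LPLo.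
- move=> _ _ /set_mem[M redM <-] /set_mem[N redN <-].
  rewrite !psiAE // => /A_class_eqP MN; apply/Gamma_class_eqP => //.
  by apply: (A_equiv_psi q1) MN; exact: qM.
- move=> _ [C /= /(ordered_is_psi q1 eq)[M redM <-] <-].
  by exists (Gamma_class (nabla_red n e) M); [exists M | exact: psiAE].
Qed.
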